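(* There is an absolute constant $C>0$ such that for all $\mu,\nu$ satisfying the standing assumptions and every $\varepsilon>0$ there exists a convex continuously differentiable function $\psi_\varepsilon:\mathbb R^d\to\mathbb R$ such that $\operatorname{spt}\pi_\varepsilon$ concentrates around the graph $\operatorname{gr}\nabla\psi_\varepsilon=\{(x,\nabla\psi_\varepsilon(x)):x\in\mathbb R^d\}$ of $\nabla\psi_\varepsilon$, i.e. $$\operatorname{dist}(\operatorname{spt}\pi_\varepsilon;\operatorname{gr}\nabla\psi_\varepsilon)\le C\sqrt{\delta(\varepsilon)}.$$
   Context: Work in $\mathbb R^d$, $d\in\mathbb N$, with Euclidean norm; $B(x,r)$ is the open ball. Standing assumptions: $\mu$ is a Borel probability measure on $\mathbb R^d$, absolutely continuous with respect to Lebesgue measure, $\operatorname{spt}\mu\subseteq B(0,1)$, and the interior of $\operatorname{spt}\mu$ is connected; $\nu$ is a Borel probability measure on $\mathbb R^d$ with $\operatorname{spt}\nu\subseteq B(0,1)$. Put $c(x,y)=\tfrac12\|x-y\|^2$ and $\mathbb P=\mu\otimes\nu$ (so $\operatorname{spt}\mathbb P=\operatorname{spt}\mu\times\operatorname{spt}\nu$). $\varepsilon$-spread of $\mu$: $\delta(\varepsilon):=\inf\{r>0: r\cdot\rho(r)>\varepsilon\}$, where $\rho(r):=\inf_{x\in\operatorname{spt}\mu}\mu(B(x,r))$. Quadratically regularized optimal transport: for $\varepsilon>0$, $\pi_\varepsilon$ is the unique minimizer over couplings $\pi$ of $\mu$ and $\nu$ of $\int c\,d\pi+\frac{\varepsilon}{2}\|\frac{d\pi}{d\mathbb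 P}\|^2_{L^2(\mathbb P)}$. It has density $\frac{d\pi_\varepsilon}{d\mathbb P}(x,y)=\frac1\varepsilon[f_\varepsilon(x)+g_\varepsilon(y)-c(x,y)]_+$, where the optimal dual potentials $f_\varepsilon,g_\varepsilon:\mathbb R^d\to\mathbb R$ are continuous and determined, up to a constant shift $(f_\varepsilon+a,g_\varepsilon-a)$, by $$\int[f_\varepsilon(x)+g_\varepsilon(y)-c(x,y)]_+\,\mu(dx)=\varepsilon\ \ \forall y\in\mathbb R^d,\qquad \int[f_\varepsilon(x)+g_\varepsilon(y)-c(x,y)]_+\,\nu(dy)=\varepsilon\ \ \forall x\in\mathbb R^d.$$ The support of $\pi_\varepsilon$ is $\operatorname{spt}\pi_\varepsilon:=\overline{\{(x,y)\in\operatorname{spt}\mathbb P: f_\varepsilon(x)+g_\varepsilon(y)>c(x,y)\}}$. For $A,B\subseteq\mathbb R^d\times\mathbb R^d$, $\operatorname{dist}(A;B):=\sup_{a\in A}\inf_{b\in B}\|a-b\|$ (Euclidean norm on $\mathbb R^d\times\mathbb R^d$). *)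

(* Defs.v *)
From HB Require Import structures.
From mathcomp Require Import all_boot all_order all_algebra.
From mathcomp Require Import all_classical all_reals all_analysis.

Set Implicit Arguments.
Unset Strict Implicit.
Unset Printing Implicit Defensive.

Import Order.TTheory GRing.Theory Num.Theory.
Import numFieldNormedType.Exports.

Local Open Scope classical_set_scope.
Local Open Scope ring_scope.

(* Borel sigma-algebra on matrices, hence on R^d = 'rV[R]_d.  The product
   'rV[R]_d * 'rV[R]_d then carries the library's product sigma-algebra (and
   product topology). *)
HB.instance Definition _ (R : realType) (m n : nat) :=
  @isMeasurable.Build (sigma_display (@open 'M[R]_(m, n))) 'M[R]_(m, n)
    <<s @open 'M[R]_(m, n) >>
    (@sigma_algebra0 _ setT (@open 'M[R]_(m, n)))
    (@sigma_algebraC _ (@open 'M[R]_(m, n)))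
    (@sigma_algebra_bigcup _ setT (@open 'M[R]_(m, n))).

Section euclidean.
Context {R : realType} {d : nat}.
Implicit Types x y : 'rV[R]_d.

(* The library's norm `|x| on 'rV[R]_d is the sup norm (same topology), so the
   Euclidean norm and balls are introduced here. *)
Definition sqnorm x : R := \sum_(i < d) x 0 i ^+ 2.

Definition enorm x : R := Num.sqrt (sqnorm x).

Definition eball x (r : R) : set 'rV[R]_d := [set y | enorm (y - x) < r].

Definition edist2 (a b : 'rV[R]_d * 'rV[R]_d) : R :=
  Num.sqrt (sqnorm (a.1 - b.1) + sqnorm (a.2 - b.2)).

(* One-sided distance sup_{a in A} inf_{b in B} |a - b|. *)
Definition excess (A B : set ('rV[R]_d * 'rV[R]_d)) : \bar R :=
  ereal_sup [set ereal_inf [set (edist2 a b)%:E | b in B] | a in A].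

Definition gradient (psi : 'rV[R]_d -> R) x : 'rV[R]_d :=
  \row_(i < d) 'D_(delta_mx 0 i) psi x.

Definition C1 (psi : 'rV[R]_d -> R) : Prop :=
  (forall x, differentiable psi x) /\ continuous (gradient psi).

Definition gradient_graph (psi : 'rV[R]_d -> R) :
    set ('rV[R]_d * 'rV[R]_d) :=
  [set (x, gradient psi x) | x in setT].

Definition box (a b : 'rV[R]_d) : set 'rV[R]_d :=
  [set x | forall i, a 0 i <= x 0 i < b 0 i].

Definition box_volume (a b : 'rV[R]_d) : R :=
  \prod_(i < d) Num.max 0 (b 0 i - a 0 i).

(* Infimum over countable covers by half-open boxes; on Borel sets this is
   Lebesgue measure. *)
Definition lebesgue_outer (A : set 'rV[R]_d) : \bar R :=
  ereal_inf [set (\sum_(0 <= k <oo) (box_volume (ab k).1 (ab k).2)%:E)%E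
            | ab in [set ab : nat -> 'rV[R]_d * 'rV[R]_d |
                     A `<=` \bigcup_k box (ab k).1 (ab k).2]].

End euclidean.

Definition spt {R : realType} {T : topologicalType} (m : set T -> \bar R) :
    set T :=
  [set x | forall U : set T, open U -> U x -> (0 < m U)%E].

Section standing_assumptions.
Context {R : realType} {d : nat}.

Definition abs_continuous (mu : probability 'rV[R]_d R) : Prop :=
  forall A : set 'rV[R]_d, measurable A -> lebesgue_outer A = 0%E ->
    mu A = 0%E.

Definition source_assumptions (mu : probability 'rV[R]_d R) : Prop :=
  [/\ abs_continuous mu, spt mu `<=` eball 0 1 & connected (spt mu)°].

Definition target_assumptions (nu : probability 'rV[R]_d R) : Prop :=
  spt nu `<=` eball 0 1.

Definition ball_mass (mu : probability 'rV[R]_d R) (r : R) : \bar R :=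
  ereal_inf [set mu (eball x r) | x in spt mu].

Definition spread (mu : probability 'rV[R]_d R) (eps : R) : R :=
  inf [set r : R | 0 < r /\ (eps%:E < r%:E * ball_mass mu r)%E].

End standing_assumptions.

Section quadratically_regularized_transport.
Context {R : realType} {d : nat}.
Variables (eps : R) (mu nu : probability 'rV[R]_d R).

Definition product_law : probability ('rV[R]_d * 'rV[R]_d)%type R :=
  (mu \x nu)%E.

Local Notation P := product_law.

Definition cost (x y : 'rV[R]_d) : R := sqnorm (x - y) / 2.

Definition coupling (pi : probability ('rV[R]_d * 'rV[R]_d)%type R) : Prop :=
  forall A : set 'rV[R]_d, measurable A ->
    pi (A `*` setT) = mu A /\ pi (setT `*` A) = nu A.

(* The squared L^2(P)-norm of dpi/dP, equal to +oo if pi is not absolutely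
   continuous with respect to P. *)
Definition density_sqnorm (pi : probability ('rV[R]_d * 'rV[R]_d)%type R) :
    \bar R :=
  (if `[< pi `<< P >] then
     \int[P]_z (Radon_Nikodym (charge_of_finite_measure pi) P z) ^+ 2
   else +oo)%E.

Definition qot_objective (pi : probability ('rV[R]_d * 'rV[R]_d)%type R) :
    \bar R :=
  (\int[pi]_z (cost z.1 z.2)%:E + (eps / 2)%:E * density_sqnorm pi)%E.

Definition qot_minimizer (pi : probability ('rV[R]_d * 'rV[R]_d)%type R) :
    Prop :=
  coupling pi /\
  forall pi' : probability ('rV[R]_d * 'rV[R]_d)%type R,
    coupling pi' -> (qot_objective pi <= qot_objective pi')%E.

Definition slack_pos (f g : 'rV[R]_d -> R) (x y : 'rV[R]_d) : R :=
  Num.max 0 (f x + g y - cost x y).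

Definition qot_potentials (f g : 'rV[R]_d -> R) : Prop :=
  [/\ continuous f, continuous g,
      forall y, (\int[mu]_x (slack_pos f g x y)%:E)%E = eps%:E &
      forall x, (\int[nu]_y (slack_pos f g x y)%:E)%E = eps%:E].

Definition qot_density (pi : probability ('rV[R]_d * 'rV[R]_d)%type R)
    (f g : 'rV[R]_d -> R) : Prop :=
  forall A : set ('rV[R]_d * 'rV[R]_d), measurable A ->
    pi A = (\int[P]_(z in A) (eps^-1 * slack_pos f g z.1 z.2)%:E)%E.

(* pi is the optimal coupling and (f, g) are its dual potentials; f and g are
   unique only up to a shift (f + a, g - a). *)
Definition qot_solution (pi : probability ('rV[R]_d * 'rV[R]_d)%type R)
    (f g : 'rV[R]_d -> R) : Prop :=
  [/\ qot_minimizer pi, qot_potentials f g & qot_density pi f g].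

(* Support of the optimal coupling; invariant under the shift of (f, g). *)
Definition qot_support (f g : 'rV[R]_d -> R) : set ('rV[R]_d * 'rV[R]_d) :=
  closure [set z | spt P z /\ cost z.1 z.2 < f z.1 + g z.2].

End quadratically_regularized_transport.

(* Main.v *)
Require Import Defs.
From HB Require Import structures.
From mathcomp Require Import all_boot all_order all_algebra.
From mathcomp Require Import all_classical all_reals all_analysis.
From mathcomp Require Import measurable_realfun ring lra.
Import Order.TTheory GRing.Theory Num.Theory.
Import numFieldNormedType.Exports.
Local Open Scope classical_set_scope.
Local Open Scope ring_scope.

(** Write [phi x = |x|^2/2 - f x] and [gam y = |y|^2/2 - g y], so that
    [f x + g y - cost x y = <x, y> - phi x - gam y].  The support of the optimal
    coupling lies in the set where this pairing is nonnegative, and the point is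
    that the pairing cannot be large either.

    Because [nu] lives in the unit ball, the marginal equation in [y] forces
    [phi] to be 1-Lipschitz ([marginal_lipschitz]).  Hence, for [|y| <= 1], the
    pairing is 2-Lipschitz in [x]; if it exceeded [3 r] at some point of
    [spt mu], it would exceed [r] on the ball of radius [r] around that point,
    and its integral would be at least [r] times the least mass of such a ball.
    For [r] just above the spread this is more than [eps], against the other
    marginal equation ([pairing_le_spread]).

    Consequently, with [eta = 3 * spread mu eps], any two points [(x, y)] and
    [(x', y')] of the support satisfy [phi x' >= phi x + <y, x' - x> - eta]: the
    vector [y] is a subgradient of [phi] at [x] up to [eta], as far as the
    points of the support can tell.  Let [w] be the supremum of the affine
    functions [z |-> phi x + <y, z - x>] over the support.  It is finite, convex
    and 1-Lipschitz, and [y] is an [eta]-subgradient of [w] at [x].  Minty's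
    trick then finds a genuine subgradient nearby: writing [x + y = p + v] with
    [v] a subgradient of [w] at [p] ([prox_exists]), one has
    [|x - p|^2 = |y - v|^2 <= eta].

    Finally [w] is made smooth by its Moreau envelope [psi] with parameter
    [l = sqrt (spread mu eps)], whose gradient at [p + l v] is [v]
    ([moreau_envelope]).  Since [|v| <= 1] the additional displacement is at
    most [l], and the distance from [(x, y)] to the graph of the gradient is at
    most [sqrt (3 * eta + 2 * l^2) = sqrt (11 * spread mu eps)]. *)

Set Implicit Arguments.
Unset Strict Implicit.
Unset Printing Implicit Defensive.

(** * The Euclidean inner product on row vectors *)

Section dot.
Context {R : realType} {d : nat}.
Implicit Types (x y z : 'rV[R]_d) (a : R).

Definition dot x y : R := \sum_(i < d) x 0 i * y 0 i.

Lemma dotC x y : dot x y = dot y x.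
Proof. by apply: eq_bigr => i _; rewrite mulrC. Qed.

Lemma dotDl x y z : dot (x + y) z = dot x z + dot y z.
Proof. by rewrite -big_split; apply: eq_bigr => i _; rewrite mxE mulrDl. Qed.

Lemma dotZl a x y : dot (a *: x) y = a * dot x y.
Proof. by rewrite mulr_sumr; apply: eq_bigr => i _; rewrite mxE mulrA. Qed.

Lemma dotNl x y : dot (- x) y = - dot x y.
Proof. by rewrite -scaleN1r dotZl mulN1r. Qed.

Lemma dotDr x y z : dot z (x + y) = dot z x + dot z y.
Proof. by rewrite dotC dotDl !(dotC z). Qed.

Lemma dotZr a x y : dot y (a *: x) = a * dot y x.
Proof. by rewrite dotC dotZl dotC. Qed.

Lemma dotNr x y : dot y (- x) = - dot y x.
Proof. by rewrite dotC dotNl dotC. Qed.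

Lemma dot0r x : dot x 0 = 0.
Proof. by rewrite -(scale0r 0) dotZr mul0r. Qed.

Definition dotE := (dotDl, dotDr, dotNl, dotNr, dotZl, dotZr).

Lemma dot_delta x i : dot x (delta_mx 0 i) = x 0 i.
Proof.
rewrite /dot (bigD1 i) //= mxE !eqxx mulr1 big1 ?addr0 // => j ji.
by rewrite mxE (negPf ji) andbF mulr0.
Qed.

Lemma sqnormE x : sqnorm x = dot x x.
Proof. by apply: eq_bigr => i _; rewrite expr2. Qed.

Lemma sqnorm_ge0 x : 0 <= sqnorm x.
Proof. by apply: sumr_ge0 => i _; exact: sqr_ge0. Qed.

Lemma sqnorm0 : sqnorm (0 : 'rV[R]_d) = 0.
Proof. by rewrite sqnormE -(scale0r 0) dotZl mul0r. Qed.

Lemma sqnorm0_eq0 x : sqnorm x = 0 -> x = 0.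
Proof.
move=> /eqP; rewrite psumr_eq0; last by move=> i _; exact: sqr_ge0.
move=> /allP x0; apply/rowP => i; rewrite mxE; apply/eqP.
by rewrite -sqrf_eq0; apply: x0; rewrite mem_index_enum.
Qed.

Lemma sqnormN x : sqnorm (- x) = sqnorm x.
Proof. by rewrite !sqnormE !dotE opprK. Qed.

Lemma sqnormB_le x y : sqnorm (x - y) <= 2 * (sqnorm x + sqnorm y).
Proof.
have := sqnorm_ge0 (x + y).
rewrite !sqnormE !dotE (dotC y x); lra.
Qed.

Lemma enorm_ge0 x : 0 <= enorm x.
Proof. exact: sqrtr_ge0. Qed.

Lemma enorm_sqr x : enorm x ^+ 2 = sqnorm x.
Proof. by rewrite sqr_sqrtr // sqnorm_ge0. Qed.

Lemma enorm_le x a : 0 <= a -> (enorm x <= a) = (sqnorm x <= a ^+ 2).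
Proof. by move=> a0; rewrite -enorm_sqr ler_sqr ?nnegrE ?enorm_ge0. Qed.

Lemma enorm_lt x a : 0 <= a -> (enorm x < a) = (sqnorm x < a ^+ 2).
Proof. by move=> a0; rewrite -enorm_sqr ltr_sqr ?nnegrE ?enorm_ge0. Qed.

Lemma enormN x : enorm (- x) = enorm x.
Proof. by rewrite /enorm sqnormN. Qed.

Lemma enormBC x y : enorm (x - y) = enorm (y - x).
Proof. by rewrite -enormN opprB. Qed.

Lemma cauchy_schwarz x y : dot x y <= enorm x * enorm y.
Proof.
have [y0|] := eqVneq (sqnorm y) 0.
  by rewrite (sqnorm0_eq0 y0) -(scale0r (0 : 'rV[R]_d)) dotZr mul0r mulr_ge0 ?enorm_ge0.
move=> yn0; have yp : 0 < sqnorm y by rewrite lt_def yn0 sqnorm_ge0.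
(* Expand the square of the component of x orthogonal to y. *)
have H : 0 <= sqnorm y * (sqnorm x * sqnorm y - dot x y ^+ 2).
  have := sqnorm_ge0 (sqnorm y *: x - dot x y *: y).
  rewrite (sqnormE (_ - _)) !dotE (dotC y x) -!sqnormE => h.
  by apply: (le_trans h); rewrite le_eqVlt; apply/orP; left; apply/eqP; ring.
rewrite pmulr_rge0 // subr_ge0 -!enorm_sqr -exprMn in H.
have := mulr_ge0 (enorm_ge0 x) (enorm_ge0 y).
move=> p; rewrite leNgt; apply/negP => lt; move: H; apply/negP.
by rewrite -ltNge ltr_sqr ?nnegrE // (le_trans p (ltW lt)).
Qed.

Lemma enorm_lipschitz x y z : enorm (x - z) - enorm (y - z) <= enorm (x - y).
Proof.
rewrite lerBlDr enorm_le ?addr_ge0 ?enorm_ge0 // sqrrD !enorm_sqr.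
have -> : x - z = (x - y) + (y - z) by rewrite addrA subrK.
have := cauchy_schwarz (x - y) (y - z).
set p := x - y; set q := y - z; clearbody p q.
rewrite !sqnormE !dotE (dotC q p) mulr2n; lra.
Qed.

Lemma normr_dot x y : `|dot x y| <= enorm x * enorm y.
Proof.
by rewrite ler_norml cauchy_schwarz lerNl -dotNl -(enormN x) cauchy_schwarz.
Qed.

(** This and the next lemmas compare the Euclidean norm with the sup norm that
    defines the topology, so that Euclidean estimates yield continuity. *)
Lemma mx_norm_le_enorm x : `|x| <= enorm x.
Proof.
rewrite [`|x|]mx_normrE; apply: bigmax_le => [|[i j] _ /=]; first exact: enorm_ge0.
rewrite (ord1 i) -ler_sqr ?nnegrE ?enorm_ge0 // enorm_sqr real_normK ?num_real //.
by rewrite /sqnorm (bigD1 j) //= lerDl sumr_ge0 // => k _; exact: sqr_ge0.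
Qed.

Lemma sqnorm_le_mx_norm x : sqnorm x <= d%:R * `|x| ^+ 2.
Proof.
rewrite -[d in d%:R]card_ord -sum1_card natr_sum mulr_suml; apply: ler_sum => i _.
rewrite mul1r -[X in X <= _]real_normK ?num_real // ler_sqr ?nnegrE //.
by rewrite [leRHS]mx_normrE; apply: (le_bigmax _ (fun ij => `|x ij.1 ij.2|) (0, i)).
Qed.

Lemma enorm_le_mx_norm x : enorm x <= Num.sqrt d%:R * `|x|.
Proof.
rewrite enorm_le ?mulr_ge0 ?sqrtr_ge0 // exprMn sqr_sqrtr ?ler0n //.
exact: sqnorm_le_mx_norm.
Qed.

Lemma sqnorm_continuous : continuous (@sqnorm R d).
Proof.
apply: continuous_big => [|i _ x]; first exact: add_continuous.
have c : (fun M : 'rV[R]_d => M 0 i) M @[M --> x] --> x 0 i by exact: coord_continuous.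
by under eq_fun do rewrite expr2; exact: (cvgM c c).
Qed.

Lemma elipschitz_continuous (W : normedModType R) (F : 'rV[R]_d -> W) (L : R) :
  (forall x y, `|F x - F y| <= L * enorm (x - y)) -> continuous F.
Proof.
move=> FL x.
apply/(@cvgrPdist_le _ W _ (nbhs x) _ F (F x)) => e e0.
have M0 : 0 < `|L| * Num.sqrt d%:R + 1 by rewrite ltr_wpDl // mulr_ge0 ?sqrtr_ge0.
have := nbhsx_ballx x _ (divr_gt0 e0 M0); apply: filterS => y.
rewrite -ball_normE /= ltr_pdivlMr // => /ltW; apply: le_trans.
apply: le_trans (FL _ _) _; apply: (@le_trans _ _ (`|L| * enorm (x - y))).
  by rewrite ler_wpM2r ?enorm_ge0 ?ler_norm.
rewrite [leRHS]mulrC mulrDl mul1r -mulrA ler_wpDr // ler_wpM2l //.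
exact: enorm_le_mx_norm.
Qed.

Lemma dot_continuous y : continuous (dot y).
Proof.
apply: (@elipschitz_continuous _ _ (enorm y)) => x x'.
by rewrite -dotNr -dotDr normr_dot.
Qed.

End dot.

(** * Subgradients and the Moreau envelope *)

Section convex.
Context {R : realType} {d : nat}.
Implicit Types (x y z p v w : 'rV[R]_d) (u psi : 'rV[R]_d -> R).

Lemma dot_is_linear y : linear (dot y : 'rV[R]_d -> R^o).
Proof. by move=> a x z; rewrite dotDr dotZr. Qed.

HB.instance Definition _ y :=
  GRing.isLinear.Build R 'rV[R]_d R^o *:%R (dot y) (dot_is_linear y).

Definition subgradient u p v := forall w, u p + dot v (w - p) <= u w.

Lemma subgradient_monotone u p v q w : subgradient u p v -> subgradient u q w ->
  0 <= dot (v - w) (p - q).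
Proof.
move=> /(_ q) + /(_ p); rewrite !dotE; lra.
Qed.

(** An affine function touching [psi] from below, with a quadratic bound from
    above, determines the derivative: the error is [O(|w - z|^2)]. *)
Lemma quadratic_differentiable psi z v (K : R) :
  (forall w, psi z + dot v (w - z) <= psi w
               <= psi z + dot v (w - z) + K * sqnorm (w - z)) ->
  differentiable psi z /\ gradient psi z = v.
Proof.
move=> H.
have oE : psi \o shift z = cst (psi z) + (dot v : 'rV[R]_d -> R^o) +o_ (0 : 'rV[R]_d) id.
  apply/eqaddoP => e e0.
  have M0 : 0 < `|K| * d%:R + 1 by rewrite ltr_wpDl // mulr_ge0 ?ler0n.
  have := nbhsx_ballx (0 : 'rV[R]_d) _ (divr_gt0 e0 M0); apply: filterS => h.
  rewrite -ball_normE /= sub0r normrN ltr_pdivlMr // => hK.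
  rewrite -[(_ - _) h]/(psi (h + z) - (psi z + dot v h)).
  have := H (h + z); rewrite addrK => /andP[h1 h2].
  rewrite ger0_norm ?subr_ge0 // lerBlDl (le_trans h2) // lerD2l.
  apply: (@le_trans _ _ (`|K| * (d%:R * `|h| ^+ 2))).
    apply: (@le_trans _ _ (`|K| * sqnorm h)).
      by rewrite ler_wpM2r ?sqnorm_ge0 ?ler_norm.
    by rewrite ler_wpM2l ?sqnorm_le_mx_norm.
  have := normr_ge0 h; move: hK; rewrite expr2; nra.
have dE := diff_unique (@dot_continuous R d v) oE.
have dpsi : differentiable psi z.
  apply/diff_locallyP; rewrite dE; split => //; exact: dot_continuous.
split => //; apply/rowP => i; rewrite mxE deriveE //.
by rewrite dE; exact: dot_delta.
Qed.

Lemma supported_convex psi (G : 'rV[R]_d -> 'rV[R]_d) :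
  (forall z, subgradient psi z (G z)) ->
  convex_function [set: convex_lmodType 'rV[R]_d] psi.
Proof.
move=> H.
have key (x y : 'rV[R]_d) (s : R) : 0 <= s -> 0 <= 1 - s ->
    psi (s *: x + (1 - s) *: y) <= s * psi x + (1 - s) * psi y.
  move=> s0 s1; set m := _ + _.
  have := H m x; have := H m y => hy hx.
  have e : s * dot (G m) (x - m) + (1 - s) * dot (G m) (y - m) = 0.
    rewrite -!dotZr -dotDr (_ : _ + _ = 0) ?dot0r //.
    by apply/rowP => i; rewrite !mxE; ring.
  nra.
move=> t x y _ _ /=; rewrite convRE.
by apply: key => //; rewrite subr_ge0.
Qed.

(** The envelope is [psi z = inf_q (u q + |z - q|^2 / (2 l))].  The infimum is
    attained at the point [p] of the hypothesis, so [psi] can be defined by its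
    value there, and everything follows from the single lower bound [lo], a
    strengthened gradient inequality: its symmetric form is the upper bound, and
    together they make [v] Lipschitz with constant [l^-1]. *)
Lemma moreau_envelope u (l : R) : 0 < l ->
  (forall z, exists p, subgradient u p (l^-1 *: (z - p))) ->
  exists psi, [/\ convex_function [set: convex_lmodType 'rV[R]_d] psi, C1 psi &
    forall p v, subgradient u p v -> gradient psi (p + l *: v) = v].
Proof.
move=> l0 prox.
have {prox}[v vP] : exists v : 'rV[R]_d -> 'rV[R]_d,
    forall z, subgradient u (z - l *: v z) (v z).
  have [p pP] := choice prox; exists (fun z => l^-1 *: (z - p z)) => z.
  by rewrite scalerA divff ?gt_eqF // scale1r subKr.
pose psi z := u (z - l *: v z) + l / 2 * sqnorm (v z).
(* The gradient inequality gains a square because v w is a subgradient at the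
   point w - l v w, not at w itself. *)
have lo z w : psi z + dot (v z) (w - z) + l / 2 * sqnorm (v w - v z) <= psi w.
  have := vP z (w - l *: v w).
  rewrite /psi !sqnormE !dotE (dotC (v w) (v z)); lra.
have up z w : psi w <= psi z + dot (v z) (w - z) + (2 * l)^-1 * sqnorm (w - z).
  have sq : 0 <= (2 * l)^-1 * sqnorm ((w - z) - l *: (v w - v z)).
    by rewrite mulr_ge0 ?sqnorm_ge0 // invr_ge0 mulr_ge0 // ltW.
  move: (lo w z) sq.
  set D := v w - v z; have -> : v z = v w - D by rewrite /D subKr.
  have -> : v w - D - v w = - D by rewrite addrAC subrr add0r.
  rewrite -(opprB w z); set h := w - z; clearbody h D.
  have -> : (2 * l)^-1 * sqnorm (h - l *: D) =
      (2 * l)^-1 * sqnorm h - dot D h + l / 2 * sqnorm D.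
    by rewrite !sqnormE !dotE (dotC D); field; rewrite gt_eqF.
  rewrite sqnormN !dotE; lra.
have gradE z : differentiable psi z /\ gradient psi z = v z.
  apply: (@quadratic_differentiable _ _ _ (2 * l)^-1) => w.
  rewrite up andbT; apply: le_trans (lo z w); rewrite lerDl mulr_ge0 ?sqnorm_ge0 ?divr_ge0 ?ltW //.
have gE : gradient psi = v by apply/funext => z; have [] := gradE z.
exists psi; split.
- apply: (@supported_convex _ v) => z w; apply: le_trans (lo z w).
  by rewrite lerDl mulr_ge0 ?sqnorm_ge0 ?divr_ge0 ?ltW //.
- split; first by move=> z; have [] := gradE z.
  rewrite gE; apply: (@elipschitz_continuous _ _ _ _ l^-1) => z w.
  apply: le_trans (mx_norm_le_enorm _) _.
  rewrite enorm_le ?mulr_ge0 ?invr_ge0 ?enorm_ge0 ?(ltW l0) // exprMn enorm_sqr.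
  have := lo w z; have := up w z.
  rewrite exprVn ler_pdivlMl ?exprn_gt0 //.
  move=> h1 h2; have := le_trans h2 h1; rewrite lerD2l ler_pdivlMl ?mulr_gt0 //.
  by have -> : 2 * l * (l / 2 * sqnorm (v z - v w)) = l ^+ 2 * sqnorm (v z - v w)
    by field.
(* Resolvents are single valued: subtracting the two subgradient inequalities
   at p and at z - l v z leaves -l |w - v z|^2 >= 0. *)
- move=> p w pw; rewrite gE; set z := p + l *: w.
  have := subgradient_monotone pw (vP z).
  have -> : p - (z - l *: v z) = - (l *: (w - v z)).
    by apply/rowP => i; rewrite !mxE; ring.
  rewrite dotNr dotZr -sqnormE oppr_ge0 pmulr_rle0 // => h.
  have /sqnorm0_eq0/eqP : sqnorm (w - v z) = 0.
    by apply/eqP; rewrite eq_le h sqnorm_ge0.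
  by rewrite subr_eq0 => /eqP.
Qed.

Definition elipschitz1 u := forall x y, u x - u y <= enorm (x - y).

Definition euclidean_convex u := forall x y (t : R), 0 <= t <= 1 ->
  u (x + t *: (y - x)) <= (1 - t) * u x + t * u y.

Lemma elipschitz1_continuous u : elipschitz1 u -> continuous u.
Proof.
move=> uL; apply: (@elipschitz_continuous _ _ _ _ 1) => x y.
by rewrite mul1r ler_norml uL lerNl opprB enormBC uL.
Qed.

(** The point [p] minimizes [u q + |z - q|^2 / (2 l)]; comparing the minimum
    with the values on the segment from [p] to [w] and letting the step tend to
    zero turns minimality into the subgradient inequality. *)
Lemma prox_exists u (l : R) z : 0 < l -> elipschitz1 u -> euclidean_convex u ->
  exists p, subgradient u p (l^-1 *: (z - p)).
Proof.
move=> l0 uL uC.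
(* Beyond the radius 2 l the quadratic term outweighs the possible linear
   decrease of u, so the minimum over this ball is global. *)
pose K := [set h : 'rV[R]_d | sqnorm h <= (2 * l) ^+ 2].
have l2 : 0 <= 2 * l by rewrite mulr_ge0 // ltW.
have K0 : K !=set0 by exists 0; rewrite /K /= sqnorm0 sqr_ge0.
have cK : compact K.
  apply: bounded_closed_compact.
    exists (2 * l); split; first exact: num_real.
    move=> M ltM h; rewrite /K /= -enorm_le // => /le_trans - /(_ _ (ltW ltM)).
    by apply: le_trans; exact: mx_norm_le_enorm.
  exact: (continuous_closedP _).1 (@sqnorm_continuous R d) _ (@closed_le _ _).
pose F h := u (z + h) + (2 * l)^-1 * sqnorm h.
have cu : continuous (fun h => u (z + h)).
  apply: elipschitz1_continuous => x y.
  by apply: le_trans (uL _ _) _; rewrite opprD addrACA subrr add0r.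
have cF : continuous F.
  move=> h; apply: (cvgD (cu h)).
  by apply: (cvgM (cvg_cst _)); exact: (@sqnorm_continuous R d h).
have [h hK hmin] := compact_EVT_min K0 cK (continuous_subspaceT cF).
have {}hmin w : F h <= F w.
  have [wK|wK] := leP (sqnorm w) ((2 * l) ^+ 2); first by apply: hmin; rewrite inE.
  have := hmin 0; rewrite inE /K /= sqnorm0 sqr_ge0 => /(_ isT)/le_trans; apply.
  rewrite /F addr0 sqnorm0 mulr0 addr0.
  have := uL z (z + w); rewrite opprD addrA subrr add0r enormN => h1.
  have : enorm w <= (2 * l)^-1 * sqnorm w.
    rewrite ler_pdivlMl ?mulr_gt0 // -enorm_sqr expr2 ler_wpM2r ?enorm_ge0 //.
    by rewrite -enorm_sqr ltr_sqr ?nnegrE ?enorm_ge0 // in wK; exact: ltW.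
  by move: h1; lra.
have expand k t : (2 * l)^-1 * sqnorm (h + t *: k) =
    (2 * l)^-1 * sqnorm h + t * (l^-1 * dot h k + t * ((2 * l)^-1 * sqnorm k)).
  by rewrite !sqnormE !dotE (dotC k h); field; rewrite gt_eqF.
exists (z + h) => w.
have -> : z - (z + h) = - h by rewrite opprD addrA subrr add0r.
set k := w - (z + h).
rewrite scalerN dotNl dotZl -subr_ge0.
have key (t : R) : 0 < t <= 1 ->
    0 <= u w - (u (z + h) - l^-1 * dot h k) + t * ((2 * l)^-1 * sqnorm k).
  move=> /andP[t0 t1]; have := hmin (h + t *: k); rewrite /F addrA.
  have := uC (z + h) w t; rewrite (ltW t0) t1 => /(_ isT); rewrite -/k.
  rewrite expand.
  move=> h1 h2; rewrite -(pmulr_rge0 _ t0); move: h1 h2; lra.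
rewrite leNgt; apply/negP; set g := u w - _ => g0.
have := sqnorm_ge0 k; move: key; rewrite -/g; set s := (2 * l)^-1 * sqnorm k => key _.
have s0 : 0 <= s by rewrite mulr_ge0 ?invr_ge0 ?sqnorm_ge0.
have m0 : 0 < s - g by lra.
(* If g < 0, this step makes g + t * s still negative; the denominator exceeds
   - g, so the step is admissible, and s = 0 causes no trouble. *)
have tP : 0 < - g / (2 * (s - g)) <= 1.
  rewrite divr_gt0 ?mulr_gt0 ?oppr_gt0 //= ler_pdivrMr ?mulr_gt0 //; lra.
have := key _ tP; apply/negP; rewrite -ltNge.
have -> : g + - g / (2 * (s - g)) * s = g * ((s - 2 * g) / (2 * (s - g))).
  by field; rewrite gt_eqF.
rewrite nmulr_rlt0 // divr_gt0 ?mulr_gt0 //; lra.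
Qed.

End convex.

(** * Approximate subgradients lie near the graph of a gradient *)

Section rough.
Context {R : realType} {d : nat}.
Implicit Types (x y z p v w : 'rV[R]_d) (u psi : 'rV[R]_d -> R).
Implicit Types (eta : R) (a : 'rV[R]_d * 'rV[R]_d) (A : set ('rV[R]_d * 'rV[R]_d)).

Definition affine_sup A u z : R := sup [set u a.1 + dot a.2 (z - a.1) | a in A].

(** Only base points of [A] are compared: for an optimal coupling the mass bound
    is available on the support of the first marginal and nowhere else. *)
Definition rough_subgradients A u (eta : R) :=
  forall a b, A a -> A b -> u a.1 + dot a.2 (b.1 - a.1) <= u b.1 + eta.

Lemma dot_le_enorm v w : enorm v <= 1 -> dot v w <= enorm w.
Proof.
move=> v1; apply: le_trans (cauchy_schwarz _ _) _.
by rewrite -[leRHS]mul1r ler_wpM2r ?enorm_ge0.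
Qed.

(** The supremum is finite at [z] because any single point of [A] bounds all the
    affine functions there, through their values at its base point. *)
Lemma affine_sup_ge A u eta a z : A !=set0 ->
  (forall a, A a -> enorm a.2 <= 1) -> rough_subgradients A u eta -> A a ->
  u a.1 + dot a.2 (z - a.1) <= affine_sup A u z.
Proof.
move=> [b Ab] A1 Au Aa; apply: ub_le_sup; last by exists a.
exists (u b.1 + eta + enorm (z - b.1)) => _ [c Ac <-].
have -> : z - c.1 = (b.1 - c.1) + (z - b.1) by rewrite [RHS]addrC addrA subrK.
by rewrite dotDr addrA lerD ?Au ?dot_le_enorm ?A1.
Qed.

Lemma affine_sup_le A u z t : A !=set0 ->
  (forall a, A a -> u a.1 + dot a.2 (z - a.1) <= t) ->
  affine_sup A u z <= t.
Proof.
move=> [b Ab] H; apply: ge_sup; last by move=> _ [a Aa <-]; exact: H.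
by eexists; exists b.
Qed.

Lemma affine_sup_lipschitz A u eta : A !=set0 ->
  (forall a, A a -> enorm a.2 <= 1) -> rough_subgradients A u eta ->
  elipschitz1 (affine_sup A u).
Proof.
move=> A0 A1 Au x y; rewrite lerBlDr; apply: affine_sup_le => // a Aa.
have -> : x - a.1 = (x - y) + (y - a.1) by rewrite addrA subrK.
by rewrite dotDr addrCA lerD ?dot_le_enorm ?A1 ?(affine_sup_ge _ A0 A1 Au).
Qed.

Lemma affine_sup_convex A u eta : A !=set0 ->
  (forall a, A a -> enorm a.2 <= 1) -> rough_subgradients A u eta ->
  euclidean_convex (affine_sup A u).
Proof.
move=> A0 A1 Au x y t /andP[t0 t1]; apply: affine_sup_le => // a Aa.
have t1' : 0 <= 1 - t by rewrite subr_ge0.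
have hx := ler_wpM2l t1' (affine_sup_ge x A0 A1 Au Aa).
have hy := ler_wpM2l t0 (affine_sup_ge y A0 A1 Au Aa).
apply: le_trans (lerD hx hy); rewrite !dotE; lra.
Qed.

Lemma affine_sup_rough_subgradient A u eta a z : A !=set0 ->
  (forall a, A a -> enorm a.2 <= 1) -> rough_subgradients A u eta ->
  A a ->
  affine_sup A u a.1 + dot a.2 (z - a.1) - eta <= affine_sup A u z.
Proof.
move=> A0 A1 Au Aa; apply: le_trans (affine_sup_ge z A0 A1 Au Aa).
rewrite addrAC lerD2r lerBlDr; apply: affine_sup_le => // b Ab; exact: Au.
Qed.

Lemma subgradient_enorm_le1 u p v : elipschitz1 u -> subgradient u p v ->
  enorm v <= 1.
Proof.
move=> uL /(_ (p + v)); have := uL (p + v) p.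
rewrite [p + v - p]addrAC subrr add0r -sqnormE -enorm_sqr => h1 h2.
have : enorm v ^+ 2 <= enorm v by lra.
have := enorm_ge0 v; nra.
Qed.

(** Two different parameters are at work.  The resolvent with parameter 1
    splits [x + y = p + v], which places [(p, v)] within [sqrt (2 * eta)] of
    [(x, y)] and so gives a rate of order [sqrt eta]; the envelope, with the
    free parameter [l], only serves to smooth and moves the base point by
    [l |v| <= l]. *)
Lemma rough_subgradients_near_graph A u (eta l : R) :
  A !=set0 -> (forall a, A a -> enorm a.2 <= 1) -> rough_subgradients A u eta ->
  0 < l ->
  exists psi, [/\ convex_function [set: convex_lmodType 'rV[R]_d] psi, C1 psi &
    forall a, A a -> exists z,
      edist2 a (z, gradient psi z) <= Num.sqrt (3 * eta + 2 * l ^+ 2)].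
Proof.
move=> A0 A1 Au l0; set w := affine_sup A u.
have wL : elipschitz1 w := affine_sup_lipschitz A0 A1 Au.
have wC : euclidean_convex w := affine_sup_convex A0 A1 Au.
have [psi [psiC psi1 psiG]] :=
  moreau_envelope l0 (fun z => prox_exists z l0 wL wC).
exists psi; split => // -[x y] Aa.
have [p] := prox_exists (x + y) ltr01 wL wC; rewrite invr1 scale1r.
set v := _ - p => pv.
exists (p + l *: v); rewrite (psiG _ _ pv) /edist2 /=.
have v1 := subgradient_enorm_le1 wL pv.
have pE : x - p = v - y by rewrite /v addrAC addrK.
clearbody v.
(* Minty: add the two (approximate) subgradient inequalities between x and p. *)
have sE : sqnorm (v - y) <= eta.
  have h1 := affine_sup_rough_subgradient p A0 A1 Au Aa.
  have h2 := pv x; rewrite -/w in h1.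
  move: h1 h2 => /=; rewrite -(opprB x p) pE.
  rewrite sqnormE dotNr dotDl (dotNl y) => h1 h2.
  lra.
apply: ler_wsqrtr.
have -> : x - (p + l *: v) = (v - y) - l *: v by rewrite opprD addrA pE.
have := sqnormB_le (v - y) (l *: v).
have -> : sqnorm (l *: v) = l ^+ 2 * sqnorm v.
  by rewrite !sqnormE !dotE mulrA.
have v2 : sqnorm v <= 1 by move: v1; rewrite enorm_le // expr1n.
have := ler_wpM2l (sqr_ge0 l) v2; rewrite mulr1.
rewrite -(opprB v y) sqnormN; lra.
Qed.

End rough.

(** * Supports, ball masses and the spread *)

Section borel.
Context {R : realType} {d : nat}.
Implicit Types (x y z : 'rV[R]_d) (m : probability 'rV[R]_d R).

Lemma open_borel (U : set 'rV[R]_d) : open U -> measurable U.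
Proof. by move=> oU; apply: sub_sigma_algebra. Qed.

Lemma continuous_borel (h : 'rV[R]_d -> R) : continuous h ->
  measurable_fun setT h.
Proof.
move=> /continuousP ch; apply: (measurability _ (RGenOInfty.measurableE R)).
move=> _ [_ [a ->] <-]; rewrite setTI; apply: open_borel.
by apply: ch; exact: interval_open.
Qed.

Lemma rat_row_dense x (e : R) : 0 < e ->
  exists q : 'rV[rat]_d, ball x e (map_mx ratr q).
Proof.
move=> e0.
have H (i : 'I_d) : exists q : rat, `|x 0 i - ratr q| < e.
  have /rat_in_itvoo[q] : x 0 i - e < x 0 i + e by lra.
  rewrite in_itv /= => /andP[q1 q2]; exists q.
  by rewrite ltr_norml; apply/andP; split; lra.
have [q qP] := choice H.
exists (\row_i q i); split => // i j; rewrite (ord1 i) !mxE.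
exact: qP.
Qed.

(** Each point off the support has a null neighbourhood containing a ball with
    rational centre and radius [n.+1^-1]; countably many null balls cover. *)
Lemma null_outside_spt m (U : set 'rV[R]_d) : measurable U ->
  (forall x, U x -> ~ spt m x) -> m U = 0%E.
Proof.
move=> mU Uspt.
pose b (c : 'rV[rat]_d * nat) : set 'rV[R]_d :=
  ball (map_mx ratr c.1 : 'rV[R]_d) (c.2.+1%:R^-1 : R).
pose B (k : nat) := if unpickle k is Some c then
  (if m (b c) == 0%E then b c else set0) else set0.
have mb c : measurable (b c).
  by apply: open_borel; exact: ball_open.
have BN k : m.-negligible (B k).
  rewrite /B; case: unpickle => [c|]; last exact: negligible_set0.
  case: eqP => [mbc|_]; last exact: negligible_set0.
  by exists (b c); split => //; exact: mb.
apply: measure_negligible => //.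
apply: negligibleS (negligible_bigcup BN) => x Ux.
have /existsNP[V /not_implyP[oV /not_implyP[Vx /negP]]] := Uspt _ Ux.
rewrite -leNgt measure_le0 => /eqP mV.
have /nbhs_ballP[e /= e0 eV] : nbhs x V by exact: open_nbhs_nbhs.
have [n ne] : exists n, n.+1%:R^-1 < e / 2.
  have [n ne] := ltr_add_invr (divr_gt0 e0 (ltr0Sn R 1)).
  by exists n; rewrite add0r in ne.
have n0 : 0 < n.+1%:R^-1 :> R by rewrite invr_gt0 ltr0n.
have [q xq] := rat_row_dense x n0.
exists (pickle (q, n)) => //; rewrite /B pickleK.
rewrite (_ : m (b (q, n)) == 0%E); first exact: ball_sym.
rewrite -measure_le0 -mV le_measure ?inE //; first exact: open_borel.
move=> y qy; apply: eV; apply: le_ball (ball_triangle xq qy).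
by rewrite (splitr e) lerD ?ltW.
Qed.

Lemma eball_open x (r : R) : open (eball x r).
Proof.
have [r0|r0] := leP r 0.
  rewrite (_ : eball x r = set0); first exact: open0.
  by rewrite -subset0 => y /= yr;
    have := le_lt_trans (enorm_ge0 _) (lt_le_trans yr r0); rewrite ltxx.
have c : continuous (fun y => enorm (y - x)).
  apply: (@elipschitz_continuous _ _ _ _ 1) => y z; rewrite mul1r.
  by rewrite /= ler_norml; apply/andP; split;
    [rewrite lerNl opprB (enormBC y z)|]; exact: enorm_lipschitz.
have -> : eball x r = (fun y => enorm (y - x)) @^-1` [set t | t < r] by [].
by move/continuousP: c; apply; exact: open_lt.
Qed.

Lemma eball_borel x (r : R) : measurable (eball x r).
Proof. by apply: open_borel; exact: eball_open. Qed.

Lemma mass_outside_unit_ball m : spt m `<=` eball 0 1 ->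
  m (~` eball 0 1) = 0%E.
Proof.
move=> sm; apply: null_outside_spt; first by apply: measurableC; exact: eball_borel.
by move=> x xb /sm.
Qed.

Lemma mass_unit_ball m : spt m `<=` eball 0 1 -> m (eball 0 1) = 1%E.
Proof.
move=> sm; have mB := eball_borel 0 1.
by rewrite -(setCK (eball 0 1)) probability_setC ?mass_outside_unit_ball ?sube0//;
  exact: measurableC.
Qed.

Lemma unit_ball_sub x : eball 0 1 x -> eball 0 1 `<=` eball x (2 : R).
Proof.
move=> /=; rewrite /eball /= subr0 enorm_lt // => x1 y; rewrite /= subr0 !enorm_lt //.
move=> y1; have := sqnormB_le y x; lra.
Qed.

(** Without it the infimum defining the spread would take its default value 0.
    The witness exceeds 2, so that balls of this radius around points of the
    support contain the whole unit ball and carry mass 1. *)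
Lemma spread_set_nonempty m (eps : R) : 0 < eps -> spt m `<=` eball 0 1 ->
  [set r : R | 0 < r /\ (eps%:E < r%:E * ball_mass m r)%E] !=set0.
Proof.
move=> e0 sm; exists (eps + 2) => /=; split; first by rewrite addr_gt0.
have h1 : (1 <= ball_mass m (eps + 2))%E.
  apply: le_ereal_inf_tmp => _ [x /sm xb <-].
  rewrite -(mass_unit_ball sm); apply: le_measure; rewrite ?inE; try exact: eball_borel.
  apply: subset_trans (unit_ball_sub xb) _ => y /= /lt_le_trans; apply.
  by rewrite lerDr ltW.
apply: lt_le_trans (_ : (eps + 2)%:E <= _)%E.
  by rewrite lte_fin ltrDl.
by rewrite -[leLHS]mule1 lee_wpmul2l // lee_fin addr_ge0 // ltW.
Qed.

(** Balls have mass at most 1, so [r * ball_mass m r > eps] needs [r > eps]. In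
    particular the spread is positive and can serve as a smoothing scale. *)
Lemma spread_ge m (eps : R) : 0 < eps -> spt m `<=` eball 0 1 ->
  spt m !=set0 -> eps <= spread m eps.
Proof.
move=> e0 sm [x xm]; apply: lb_le_inf; first exact: spread_set_nonempty.
move=> r [r0 er]; rewrite -lee_fin (le_trans (ltW er)) //.
rewrite -[leRHS]mule1 lee_wpmul2l ?lee_fin ?(ltW r0) //.
apply: (@le_trans _ _ (m (eball x r))); first by apply: ereal_inf_lbound; exists x.
by apply: probability_le1; exact: eball_borel.
Qed.

End borel.

(** * Estimates from the marginal equations *)

Section potentials.
Context {R : realType} {d : nat}.
Implicit Types (x y z : 'rV[R]_d) (m : probability 'rV[R]_d R).
Implicit Types (phi gam : 'rV[R]_d -> R).

Definition pos_pairing phi gam x y : R := Num.max 0 (dot x y - phi x - gam y).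

Lemma pos_pairing_ge0 phi gam x y : 0 <= pos_pairing phi gam x y.
Proof. by rewrite le_max lexx. Qed.

Lemma pos_pairing_measurable phi gam x : continuous gam ->
  measurable_fun setT (fun y => (pos_pairing phi gam x y)%:E).
Proof.
move=> cg; under eq_fun do rewrite /pos_pairing EFin_max.
apply: measurable_maxe; first exact: measurable_cst.
apply/measurable_EFinP/measurable_funB.
  apply: measurable_funB; [|exact: measurable_cst].
  by apply: continuous_borel; exact: dot_continuous.
exact: continuous_borel.
Qed.

Definition pairing_marginal m phi gam (eps : R) :=
  forall x, (\int[m]_y (pos_pairing phi gam x y)%:E)%E = eps%:E.

(** If [phi x > phi x' + |x - x'|], the pairing at [x'] dominates the pairing at
    [x] by a fixed amount [s > 0] over the whole unit ball, so their positive
    parts could have the same integral only if the pairing at [x] were almost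
    surely nonpositive; but that integral is [eps > 0]. *)
Lemma marginal_lipschitz m phi gam (eps : R) : 0 < eps ->
  spt m `<=` eball 0 1 -> continuous gam -> pairing_marginal m phi gam eps ->
  elipschitz1 phi.
Proof.
move=> e0 sm cg marg x x'; rewrite leNgt; apply/negP => gap.
pose D := @eball R d 0 1.
have mD : measurable D := eball_borel 0 1.
have mslack z : measurable_fun setT (fun y => (pos_pairing phi gam z y)%:E).
  exact: pos_pairing_measurable.
have marg' z : (\int[m]_(y in D) (pos_pairing phi gam z y)%:E)%E = eps%:E.
  rewrite -(marg z) [RHS](@ge0_negligible_integral _ _ _ m setT (~` D)) //.
  - by rewrite setTD setCK.
  - exact: measurableC.
  - by move=> y _; rewrite lee_fin pos_pairing_ge0.
  - exact: mass_outside_unit_ball.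
set s := phi x - phi x' - enorm (x - x').
have s0 : 0 < s by rewrite subr_gt0.
pose P := D `&` [set y | 0 < dot x y - phi x - gam y].
have mP : measurable P.
  apply: measurableI => //.
  have -> : [set y | 0 < dot x y - phi x - gam y] =
      (fun y => dot x y - phi x - gam y) @^-1` `]0, +oo[.
    by apply/seteqP; split => y /=; rewrite in_itv /= andbT.
  rewrite -[X in measurable X]setTI.
  apply: measurable_funB; [|exact: continuous_borel| |] => //.
  apply: measurable_funB; [|exact: measurable_cst].
  by apply: continuous_borel; exact: dot_continuous.
have le y : D y -> pos_pairing phi gam x y + s * \1_P y <= pos_pairing phi gam x' y.
  move=> Dy.
  have y1 : enorm y <= 1 by move: (Dy); rewrite /D /eball /= subr0 => /ltW.
  have h : dot x y - phi x - gam y + s <= dot x' y - phi x' - gam y.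
    have := dot_le_enorm (x - x') y1; rewrite /s dotC !dotE; lra.
  rewrite indicE /pos_pairing; have [yP|yP] := boolP (y \in P).
    move: yP; rewrite inE => -[_ /= yP].
    by rewrite mulr1 max_r ?(ltW yP) // le_max h orbT.
  rewrite mulr0 addr0 ge_max le_max lexx /= le_max; apply/orP; right.
  by apply: le_trans h; rewrite lerDl ltW.
have mPnull : m P = 0%E.
  have := @ge0_le_integral _ _ _ m D mD
    (fun y => (pos_pairing phi gam x y)%:E + (s * \1_P y)%:E)%E
    (fun y => (pos_pairing phi gam x' y)%:E).
  rewrite ge0_integralD //; last 4 first.
  - by move=> y _; rewrite lee_fin pos_pairing_ge0.
  - exact: measurable_funS (mslack x).
  - by move=> y _; rewrite lee_fin mulr_ge0 ?(ltW s0).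
  - by apply/measurable_EFinP; apply: measurable_funM => //; exact: measurable_cst.
  rewrite !marg' => H.
  have {H} : (eps%:E + \int[m]_(y in D) (s * \1_P y)%:E <= eps%:E)%E.
    apply: H.
    - by move=> y _; rewrite lee_fin addr_ge0 ?pos_pairing_ge0 ?mulr_ge0 ?(ltW s0).
    - apply: emeasurable_funD; first exact: measurable_funS (mslack x).
      by apply/measurable_EFinP; apply: measurable_funM => //; exact: measurable_cst.
    - exact: measurable_funS (mslack x').
    - by move=> y Dy; rewrite -EFinD lee_fin le.
  rewrite (integralZl_indic mD (fun=> P)) //; last by move=> /lt_trans - /(_ _ s0); rewrite ltxx.
  rewrite integral_indic // (_ : P `&` D = P); last by rewrite setIC setIA setIid.
  rewrite -[leRHS]adde0 leeD2lE // pmule_rle0 ?lte_fin // => mP0.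
  by apply/eqP; rewrite -measure_le0.
have : (\int[m]_(y in D) (pos_pairing phi gam x y)%:E)%E = 0%E.
  rewrite (@ge0_negligible_integral _ _ _ m D P) //.
  - apply: integral0_eq => y [Dy yP]; congr EFin.
    apply/max_idPl; rewrite leNgt; apply/negP => h; exact: yP.
  - exact: measurable_funS (mslack x).
  - by move=> y _; rewrite lee_fin pos_pairing_ge0.
by rewrite marg' => -[] e; rewrite e ltxx in e0.
Qed.

(** The factor 3 pays for the decrease [2 r] of the 2-Lipschitz pairing over a
    ball of radius [r], leaving the value [r] on the ball. *)
Lemma pairing_le_spread m phi gam (eps : R) x y : 0 < eps ->
  spt m `<=` eball 0 1 -> continuous phi -> elipschitz1 phi ->
  pairing_marginal m gam phi eps -> spt m x -> enorm y <= 1 ->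
  dot x y - phi x - gam y <= 3 * spread m eps.
Proof.
move=> e0 sm cphi phiL marg mx y1; rewrite leNgt; apply/negP => h.
have : spread m eps < (dot x y - phi x - gam y) / 3.
  by rewrite ltr_pdivlMr // mulrC.
move=> /(inf_lt (spread_set_nonempty e0 sm)) [r [r0 er]].
rewrite ltr_pdivlMr // => rh.
have mB := eball_borel x r.
have mB' := pos_pairing_measurable gam y cphi.
suff : (r%:E * ball_mass m r <= eps%:E)%E by rewrite leNgt er.
apply: (@le_trans _ _ (r%:E * m (eball x r))%E).
  by rewrite lee_wpmul2l ?lee_fin ?(ltW r0) //; apply: ereal_inf_lbound; exists x.
rewrite -integral_cst // -(marg y).
apply: (@le_trans _ _ (\int[m]_(z in eball x r) (pos_pairing gam phi y z)%:E)%E).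
  apply: ge0_le_integral => //.
  - by move=> z _; rewrite lee_fin ltW.
  - exact: measurable_funTS mB'.
  - move=> z /= zx; rewrite lee_fin le_max; apply/orP; right.
    have := phiL z x; have := dot_le_enorm (x - z) y1; rewrite (enormBC x z) !dotE.
    move: zx rh; rewrite /eball /= => zx rh; move: zx rh; rewrite (dotC x y); lra.
apply: ge0_subset_integral => //.
by move=> z _; rewrite lee_fin pos_pairing_ge0.
Qed.

End potentials.

(** * The support of the optimal coupling *)

Section qot.
Context {R : realType} {d : nat}.
Implicit Types (x y z : 'rV[R]_d) (mu nu : probability 'rV[R]_d R).
Implicit Types (f g : 'rV[R]_d -> R).

(** Adding the quadratic part turns the cost into the bilinear pairing, the
    form in which convex duality applies. *)
Definition convexified f x : R := sqnorm x / 2 - f x.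

Lemma convexified_continuous f : continuous f -> continuous (convexified f).
Proof.
move=> cf x; apply: (cvgB _ (cf x)).
by apply: cvgM; [exact: (@sqnorm_continuous R d x)|exact: cvg_cst].
Qed.

Lemma slack_pairing f g x y :
  f x + g y - cost x y = dot x y - convexified f x - convexified g y.
Proof. rewrite /cost /convexified !sqnormE !dotE (dotC y x); lra. Qed.

Lemma slack_posE f g x y :
  slack_pos f g x y = pos_pairing (convexified f) (convexified g) x y.
Proof. by rewrite /slack_pos slack_pairing. Qed.

Lemma slack_posE' f g x y :
  slack_pos f g x y = pos_pairing (convexified g) (convexified f) y x.
Proof.
by rewrite slack_posE /pos_pairing (dotC x y) addrAC.
Qed.

Lemma open_fst (U : set 'rV[R]_d) : open U ->
  open (U `*` setT : set ('rV[R]_d * 'rV[R]_d)).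
Proof.
rewrite setXT => oU.
have /continuousP : continuous (@fst 'rV[R]_d 'rV[R]_d) by move=> z; exact: cvg_fst.
exact.
Qed.

Lemma open_snd (U : set 'rV[R]_d) : open U ->
  open (setT `*` U : set ('rV[R]_d * 'rV[R]_d)).
Proof.
rewrite setTX => oU.
have /continuousP : continuous (@snd 'rV[R]_d 'rV[R]_d) by move=> z; exact: cvg_snd.
exact.
Qed.

Lemma spt_product mu nu (z : 'rV[R]_d * 'rV[R]_d) : spt (product_law mu nu) z ->
  spt mu z.1 /\ spt nu z.2.
Proof.
move=> sz; split=> U oU Uz.
- have := sz (U `*` setT) (open_fst oU) (conj Uz I).
  rewrite [X in (0 < X)%E -> _](_ : _ = mu U) //.
  rewrite [LHS](product_measure1E mu nu (open_borel oU) measurableT).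
  by rewrite [X in (_ * X)%E](probability_setT nu) mule1.
- have := sz (setT `*` U) (open_snd oU) (conj I Uz).
  rewrite [X in (0 < X)%E -> _](_ : _ = nu U) //.
  rewrite [LHS](product_measure1E mu nu measurableT (open_borel oU)).
  by rewrite [X in (X * _)%E](probability_setT mu) mul1e.
Qed.

Lemma slack_continuous f g : continuous f -> continuous g ->
  continuous (fun z : 'rV[R]_d * 'rV[R]_d => f z.1 + g z.2 - cost z.1 z.2).
Proof.
move=> cf cg z.
have c1 : f w.1 @[w --> z] --> f z.1 by apply: (cvg_comp _ f cvg_fst); exact: cf.
have c2 : g w.2 @[w --> z] --> g z.2 by apply: (cvg_comp _ g cvg_snd); exact: cg.
have c3 : (w.1 - w.2) @[w --> z] --> z.1 - z.2 by exact: (cvgB cvg_fst cvg_snd).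
have c4 : sqnorm (w.1 - w.2) @[w --> z] --> sqnorm (z.1 - z.2).
  by apply: (cvg_comp _ _ c3); exact: sqnorm_continuous.
apply: cvgB; first exact: cvgD.
by apply: cvgM; [exact: c4|exact: cvg_cst].
Qed.

(** The strict inequality defining the support becomes weak in the closure, and
    the open unit ball becomes closed. *)
Lemma qot_support_sub mu nu f g (z : 'rV[R]_d * 'rV[R]_d) : continuous f -> continuous g ->
  spt nu `<=` eball 0 1 -> qot_support mu nu f g z ->
  [/\ spt mu z.1, enorm z.2 <= 1 & cost z.1 z.2 <= f z.1 + g z.2].
Proof.
move=> cf cg sn cz; split.
- move=> U oU Uz.
  have [w [[/spt_product[sw _] _] Uw]] :
      [set z | spt (product_law mu nu) z /\ cost z.1 z.2 < f z.1 + g z.2]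
      `&` (U `*` setT) !=set0.
    by apply: cz; apply: open_nbhs_nbhs; split; [exact: open_fst|].
  by apply: sw => //; case: Uw.
- have : closed [set w : 'rV[R]_d * 'rV[R]_d | sqnorm w.2 <= 1].
    have c : continuous (fun w : 'rV[R]_d * 'rV[R]_d => sqnorm w.2).
      by move=> w; apply: (cvg_comp _ _ cvg_snd); exact: sqnorm_continuous.
    exact: (continuous_closedP _).1 c _ (@closed_le _ _).
  move=> cl; rewrite enorm_le // expr1n; apply: cl.
  apply: closureS cz => w [/spt_product[_ /sn]].
  by rewrite /eball /= subr0 => /ltW; rewrite enorm_le // expr1n.
- have : closed [set w | 0 <= f w.1 + g w.2 - cost w.1 w.2].
    exact: (continuous_closedP _).1 (slack_continuous cf cg) _ (@closed_ge _ _).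
  rewrite -subr_ge0; apply; apply: closureS cz => w [_ /ltW].
  by rewrite /= subr_ge0.
Qed.

End qot.

(** * Concentration around the graph of a gradient *)

Theorem theorem5p1 (R : realType) :
  exists C : R, 0 < C /\
    forall (d : nat) (mu nu : probability 'rV[R]_d R),
      (0 < d)%N -> source_assumptions mu -> target_assumptions nu ->
      forall (eps : R), 0 < eps ->
      forall (pi : probability ('rV[R]_d * 'rV[R]_d)%type R)
             (f g : 'rV[R]_d -> R),
        qot_solution eps mu nu pi f g ->
        exists psi : 'rV[R]_d -> R,
          [/\ convex_function [set: convex_lmodType 'rV[R]_d] psi,
              C1 psi &
              (excess (qot_support mu nu f g) (gradient_graph psi)
                 <= (C * Num.sqrt (spread mu eps))%:E)%E].
Proof.
exists 4; split => // d mu nu _ [_ smu _] snu eps e0 pi f g [_ [cf cg fmu gnu] _].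
set A := qot_support mu nu f g.
have AP a : A a -> [/\ spt mu a.1, enorm a.2 <= 1 & cost a.1 a.2 <= f a.1 + g a.2].
  exact: qot_support_sub.
set phi := convexified f; set gam := convexified g.
have cphi : continuous phi := convexified_continuous cf.
have cgam : continuous gam := convexified_continuous cg.
have margnu : pairing_marginal nu phi gam eps.
  by move=> x; rewrite -(gnu x); apply: eq_integral => y _; rewrite slack_posE.
have margmu : pairing_marginal mu gam phi eps.
  by move=> y; rewrite -(fmu y); apply: eq_integral => x _; rewrite slack_posE'.
have phiL := marginal_lipschitz e0 snu cgam margnu.
(* An empty support has excess -oo over any graph, so any psi will do. *)
have [A0|/nonemptyPn A0] := pselect (A !=set0); last first.
  have sub0 p : subgradient (fun=> 0 : R) p (0 : 'rV[R]_d).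
    by move=> w; rewrite dotC dot0r addr0.
  have [|psi [psiC psi1 _]] := @moreau_envelope R d (fun=> 0) 1 ltr01.
    by move=> z; exists z; rewrite subrr scaler0.
  exists psi; split => //; rewrite /excess A0 image_set0 ereal_sup0; exact: leNye.
have [a0 /AP[a0mu _ _]] := A0.
set D := spread mu eps.
have D0 : 0 < D by exact: lt_le_trans e0 (spread_ge e0 smu (ex_intro _ a0.1 a0mu)).
have Arough : rough_subgradients A phi (3 * D).
  move=> a b /AP[_ a1 ac] /AP[bmu _ _].
  have := pairing_le_spread e0 smu cphi phiL margmu bmu a1.
  move: ac; rewrite -subr_ge0 slack_pairing -/phi -/gam -/D !dotE.
  rewrite (dotC a.2 b.1) (dotC a.2 a.1); lra.
have A1 a : A a -> enorm a.2 <= 1 by case/AP.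
have sD0 : 0 < Num.sqrt D by rewrite sqrtr_gt0.
have [psi [psiC psi1 near]] := rough_subgradients_near_graph A0 A1 Arough sD0.
exists psi; split => //; apply: ge_ereal_sup => _ [a Aa <-].
have [z az] := near _ Aa; apply: ge_ereal_inf.
exists (edist2 a (z, gradient psi z))%:E.
  by exists (z, gradient psi z) => //; exists z.
rewrite lee_fin (le_trans az) //.
have -> : 4 * Num.sqrt D = Num.sqrt (4 ^+ 2 * D).
  by rewrite sqrtrM ?sqr_ge0 // sqrtr_sqr ger0_norm.
apply: ler_wsqrtr; rewrite sqr_sqrtr ?(ltW D0) //; lra.
Qed.
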